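(* Let $\{P_m(x,t)\}_{m\ge0}$ be the polynomials defined by $P_0=1$, $P_1=1-x$, and \[ P_m(x,t)=(1-x-x^2(t-1))P_{m-1}(x,t)-(x^2+x^3(t-1))P_{m-2}(x,t)\quad(m\ge2). \] Write $a=1-x-x^2(t-1)$ and $b=x^2+x^3(t-1)$. Then for $m\ge1$, \[ F_m^{\mathrm{asc}}(x,t)=\frac{P_m(x,t)}{P_{m+1}(x,t)}=\cfrac{1}{a-\cfrac{b}{a-\cfrac{b}{\ddots\, a-\cfrac{b}{1-x}}}}, \] a continued fraction in which $a$ appears $m$ times (i.e. with $m+1$ fraction bars), and \[ F^{\mathrm{asc}}(x,t)=\cfrac{1}{a-\cfrac{b}{a-\cfrac{b}{a-\cdots}}}=\frac{1-x-x^2(t-1)-\sqrt{1-2x-x^2(2t+1)-2x^3(t-1)+x^4(t-1)^2}}{2(x^2+x^3(t-1))}. \]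
   Context: A Motzkin path of length $n$ is a sequence of $n$ steps, each $U$ ($+1$), $F$ ($0$) or $D$ ($-1$), starting and ending at height $0$ and never going below height $0$; it has height bounded by $m$ if all its heights are at most $m$. An ascent of a Motzkin path is a maximal run of consecutive $U$ steps; $\mathrm{asc}\,\mu$ denotes the number of ascents of $\mu$. $\mathcal{M}_n^m$ is the set of Motzkin paths of length $n$ with height bounded by $m$ and $\mathcal{M}_n$ the set of all Motzkin paths of length $n$. $F_m^{\mathrm{asc}}(x,t)=\sum_{n\ge0}\sum_{\mu\in\mathcal{M}_n^m}t^{\mathrm{asc}\,\mu}x^n$ and $F^{\mathrm{asc}}(x,t)=\sum_{n\ge0}\sum_{\mu\in\mathcal{M}_n}t^{\mathrm{asc}\,\mu}x^n$. An infinite continued fraction denotes the formal power series limit of its finite truncations. *)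

(* Defs.v *)
From HB Require Import structures.
From mathcomp Require Import all_boot all_order all_algebra boolp.

Set Implicit Arguments.
Unset Strict Implicit.
Unset Printing Implicit Defensive.

Import Order.TTheory GRing.Theory Num.Theory.
Local Open Scope ring_scope.

Record fps (R : Type) := FPS { fps_coef : nat -> R }.

Notation "{ 'fps' R }" := (fps R) (format "{ 'fps'  R }") : type_scope.

Lemma fpsP (R : Type) (f g : {fps R}) : fps_coef f =1 fps_coef g <-> f = g.
Proof.
split=> [|-> //]; case: f => f; case: g => g /= fg.
by congr FPS; apply: funext.
Qed.

HB.instance Definition _ (R : Type) := gen_eqMixin (fps R).
HB.instance Definition _ (R : Type) := gen_choiceMixin (fps R).

Definition fps_zero (R : zmodType) : {fps R} := FPS (fun=> 0).
Definition fps_opp (R : zmodType) (f : {fps R}) : {fps R} :=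
  FPS (fun n => - fps_coef f n).
Definition fps_add (R : zmodType) (f g : {fps R}) : {fps R} :=
  FPS (fun n => fps_coef f n + fps_coef g n).

Lemma fps_addA (R : zmodType) : associative (@fps_add R).
Proof. by move=> f g h; apply/fpsP => n /=; rewrite addrA. Qed.
Lemma fps_addC (R : zmodType) : commutative (@fps_add R).
Proof. by move=> f g; apply/fpsP => n /=; rewrite addrC. Qed.
Lemma fps_add0 (R : zmodType) : left_id (@fps_zero R) (@fps_add R).
Proof. by move=> f; apply/fpsP => n /=; rewrite add0r. Qed.
Lemma fps_addN (R : zmodType) :
  left_inverse (@fps_zero R) (@fps_opp R) (@fps_add R).
Proof. by move=> f; apply/fpsP => n /=; rewrite addNr. Qed.

HB.instance Definition _ (R : zmodType) := GRing.isZmodule.Build (fps R)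
  (@fps_addA R) (@fps_addC R) (@fps_add0 R) (@fps_addN R).

Definition fps_of_poly (R : nzSemiRingType) (p : {poly R}) : {fps R} :=
  FPS (fun n => p`_n).

Notation "p %:S" := (fps_of_poly p) (at level 1, left associativity, format "p %:S")
  : ring_scope.

Definition fps_trunc (R : nzSemiRingType) (N : nat) (f : {fps R}) : {poly R} :=
  \poly_(i < N) fps_coef f i.

Definition fps_mul (R : comNzRingType) (f g : {fps R}) : {fps R} :=
  FPS (fun n => \sum_(i < n.+1) fps_coef f i * fps_coef g (n - i)%N).

Lemma fps_trunc_coef (R : comNzRingType) N (f : {fps R}) n : (n < N)%N ->
  (fps_trunc N f)`_n = fps_coef f n.
Proof. by move=> nN; rewrite coef_poly nN. Qed.

Lemma fps_mul_coef (R : comNzRingType) (f g : {fps R}) (p q : {poly R}) n :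
    (forall i, (i <= n)%N -> fps_coef f i = p`_i) ->
    (forall i, (i <= n)%N -> fps_coef g i = q`_i) ->
  fps_coef (fps_mul f g) n = (p * q)`_n.
Proof.
move=> fp gq; rewrite coefM; apply: eq_bigr => i _.
by rewrite fp ?gq ?leq_subr // -ltnS.
Qed.

Lemma fps_mul_trunc (R : comNzRingType) (f g : {fps R}) N n : (n < N)%N ->
  fps_coef (fps_mul f g) n = (fps_trunc N f * fps_trunc N g)`_n.
Proof.
by move=> nN; apply: fps_mul_coef => i le_in;
  rewrite fps_trunc_coef // (leq_ltn_trans le_in).
Qed.

Lemma fps_mulA (R : comNzRingType) : associative (@fps_mul R).
Proof.
move=> f g h; apply/fpsP => n.
rewrite (@fps_mul_coef _ _ _ (fps_trunc n.+1 f)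
  (fps_trunc n.+1 g * fps_trunc n.+1 h)); first last.
- by move=> i le_in; rewrite -fps_mul_trunc.
- by move=> i le_in; rewrite fps_trunc_coef.
rewrite (@fps_mul_coef _ _ _ (fps_trunc n.+1 f * fps_trunc n.+1 g)
  (fps_trunc n.+1 h)) ?mulrA //.
- by move=> i le_in; rewrite -fps_mul_trunc.
- by move=> i le_in; rewrite fps_trunc_coef.
Qed.

Lemma fps_mulC (R : comNzRingType) : commutative (@fps_mul R).
Proof.
by move=> f g; apply/fpsP => n; rewrite !(@fps_mul_trunc _ _ _ n.+1) // mulrC.
Qed.

Lemma fps_mul1 (R : comNzRingType) : left_id (1%:S) (@fps_mul R).
Proof.
move=> f; apply/fpsP => n.
rewrite (@fps_mul_coef _ _ _ 1 (fps_trunc n.+1 f)) ?mul1r ?fps_trunc_coef //.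
by move=> i le_in; rewrite fps_trunc_coef.
Qed.

Lemma fps_mulDl (R : comNzRingType) : left_distributive (@fps_mul R) +%R.
Proof.
move=> f g h; apply/fpsP => n /=; rewrite -big_split /=.
by apply: eq_bigr => i _; rewrite mulrDl.
Qed.

Lemma fps_one_neq0 (R : comNzRingType) : (1%:S : {fps R}) != 0.
Proof.
apply/eqP => /fpsP /(_ 0%N) /=; rewrite coef1 /= => /eqP.
by rewrite oner_eq0.
Qed.

HB.instance Definition _ (R : comNzRingType) :=
  GRing.Zmodule_isComNzRing.Build (fps R)
    (@fps_mulA R) (@fps_mulC R) (@fps_mul1 R) (@fps_mulDl R) (@fps_one_neq0 R).

Lemma fps_coef1 (R : comNzRingType) n : fps_coef (1 : {fps R}) n = (n == 0)%:R.
Proof. exact: coef1. Qed.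

Lemma fps_coefM (R : comNzRingType) (f g : {fps R}) n :
  fps_coef (f * g) n = \sum_(i < n.+1) fps_coef f i * fps_coef g (n - i)%N.
Proof. by []. Qed.

Lemma fps_of_poly_is_zmod_morphism (R : comNzRingType) :
  zmod_morphism (@fps_of_poly R).
Proof. by move=> p q; apply/fpsP => n /=; rewrite coefB. Qed.

Lemma fps_of_poly_is_monoid_morphism (R : comNzRingType) :
  monoid_morphism (@fps_of_poly R).
Proof. by split=> // p q; apply/fpsP => n /=; rewrite coefM. Qed.

HB.instance Definition _ (R : comNzRingType) :=
  GRing.isZmodMorphism.Build {poly R} (fps R) (@fps_of_poly R)
    (@fps_of_poly_is_zmod_morphism R).
HB.instance Definition _ (R : comNzRingType) :=
  GRing.isMonoidMorphism.Build {poly R} (fps R) (@fps_of_poly R)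
    (@fps_of_poly_is_monoid_morphism R).

(** The series whose n-th coefficient is [step] of the list of the n previous
    coefficients. *)

Fixpoint fps_rec_seq (R : Type) (step : seq R -> R) (n : nat) : seq R :=
  if n is n'.+1 then
    rcons (fps_rec_seq step n') (step (fps_rec_seq step n'))
  else [::].

Definition fps_rec (R : Type) (step : seq R -> R) : {fps R} :=
  FPS (fun n => step (fps_rec_seq step n)).

Lemma fps_rec_coef (R : Type) (step : seq R -> R) n :
  fps_coef (fps_rec step) n = step (mkseq (fps_coef (fps_rec step)) n).
Proof.
congr step; elim: n => [//|n IHn] /=.
by rewrite /mkseq -addn1 iotaD map_cat cats1 add0n /= {1}IHn.
Qed.

Definition fps_unit (R : comUnitRingType) : pred {fps R} :=
  fun f => fps_coef f 0 \is a GRing.unit.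

Definition fps_inv (R : comUnitRingType) (f : {fps R}) : {fps R} :=
  if fps_unit f then
    fps_rec (fun s => if size s is n.+1 then
        - (fps_coef f 0)^-1 * \sum_(i < n.+1) s`_i * fps_coef f (n.+1 - i)%N
      else (fps_coef f 0)^-1)
  else f.

Lemma fps_mulVx (R : comUnitRingType) :
  {in @fps_unit R, left_inverse 1 (@fps_inv R) *%R}.
Proof.
move=> f fU; have f0U : fps_coef f 0 \is a GRing.unit by [].
rewrite /fps_inv ifT //; set step := (step in fps_rec step).
apply/fpsP => -[|n]; rewrite fps_coefM fps_coef1.
  by rewrite big_ord1 subnn /step /= mulVr.
have recE : fps_coef (fps_rec step) n.+1 = - (fps_coef f 0)^-1 *
    \sum_(i < n.+1) fps_coef (fps_rec step) i * fps_coef f (n.+1 - i)%N.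
  rewrite fps_rec_coef {1}/step size_mkseq; congr (_ * _).
  by apply: eq_bigr => i _; rewrite nth_mkseq.
rewrite big_ord_recr (_ : fps_coef _ (val ord_max) = fps_coef (fps_rec step) n.+1) //.
by rewrite recE subnn mulrAC mulNr mulVr // mulN1r; apply: subrr.
Qed.

Lemma fps_unitPl (R : comUnitRingType) (f g : {fps R}) : g * f = 1 -> fps_unit f.
Proof.
move=> /fpsP /(_ 0%N); rewrite fps_coefM fps_coef1 big_ord1 => gf1.
by apply/unitrPr; exists (fps_coef g 0); rewrite mulrC.
Qed.

Lemma fps_inv_out (R : comUnitRingType) :
  {in [predC @fps_unit R], @fps_inv R =1 id}.
Proof. by move=> f /negbTE fU; rewrite /fps_inv (fU : fps_unit f = false). Qed.

HB.instance Definition _ (R : comUnitRingType) :=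
  GRing.ComNzRing_hasMulInverse.Build (fps R)
    (@fps_mulVx R) (@fps_unitPl R) (@fps_inv_out R).

Lemma unit_fpsE (R : comUnitRingType) (f : {fps R}) :
  (f \is a GRing.unit) = (fps_coef f 0 \is a GRing.unit).
Proof. by []. Qed.

Lemma fps_mulf_eq0 (R : idomainType) (f g : {fps R}) :
  f * g = 0 -> (f == 0) || (g == 0).
Proof.
have nz (h : {fps R}) : h != 0 -> exists n, fps_coef h n != 0.
  move=> h0; apply: contrapT => /forallNP hN; case/negP: h0; apply/eqP/fpsP => n.
  by apply/eqP; apply: contrapT => /negP; apply: hN.
move=> fg0; apply: contraT; rewrite negb_or => /andP[/nz fN /nz gN].
case: (ex_minnP fN) => i fi mini; case: (ex_minnP gN) => j gj minj.
have zmin (h : {fps R}) k m : (forall n, fps_coef h n != 0 -> (k <= n)%N) ->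
    (m < k)%N -> fps_coef h m = 0.
  by move=> mink; rewrite ltnNge => mk; apply/eqP; apply: contraNT mk => /mink.
move/fpsP: fg0 => /(_ (i + j)%N); rewrite [LHS]/= [RHS]/=.
have le_i : (i < (i + j).+1)%N by rewrite ltnS leq_addr.
rewrite (bigD1 (Ordinal le_i)) //= addKn big1 => [|k neq_ki].
  by move/eqP; rewrite addr0 mulf_eq0 (negbTE fi) (negbTE gj).
have [lt_ki|le_ik] := ltnP k i; first by rewrite (zmin _ _ _ mini) ?mul0r.
rewrite (zmin _ _ _ minj) ?mulr0 // ltn_subLR; last exact: ltn_ord k.
rewrite ltn_add2r.
by rewrite ltn_neqAle le_ik andbT; apply: contra neq_ki => /eqP ik; apply/eqP/val_inj.
Qed.

HB.instance Definition _ (R : idomainType) :=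
  GRing.ComUnitRing_isIntegral.Build (fps R) (@fps_mulf_eq0 R).

(** The square root with constant coefficient 1; meaningful when 2 is
    invertible in R and the constant coefficient of f is 1, see [fps_sqrtK]
    and [fps_sqrt_unique]. *)

Definition fps_sqrt (R : comUnitRingType) (f : {fps R}) : {fps R} :=
  fps_rec (fun s => if size s is n.+1 then
      (fps_coef f n.+1 - \sum_(1 <= i < n.+1) s`_i * s`_(n.+1 - i)) / 2
    else 1).

Lemma fps_sqrt_coef0 (R : comUnitRingType) (f : {fps R}) :
  fps_coef (fps_sqrt f) 0 = 1.
Proof. by []. Qed.

Lemma fps_sqr_coefS (R : comUnitRingType) (g : {fps R}) n :
  fps_coef g 0 = 1 -> fps_coef (g ^+ 2) n.+1 =
  \sum_(1 <= i < n.+1) fps_coef g i * fps_coef g (n.+1 - i)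
    + fps_coef g n.+1 * 2.
Proof.
move=> g0; rewrite expr2 [LHS]/= big_ord_recr big_ord_recl /= subnn subn0 g0.
rewrite mul1r mulr1 mulr_natr mulr2n addrAC addrC; congr (_ + _).
by rewrite big_add1 big_mkord; apply: eq_bigr => i _.
Qed.

Lemma fps_sqrtK (R : comUnitRingType) (f : {fps R}) :
  (2 : R) \is a GRing.unit -> fps_coef f 0 = 1 -> fps_sqrt f ^+ 2 = f.
Proof.
move=> U2 f0; apply/fpsP => -[|n].
  by rewrite expr2 fps_coefM big_ord1 fps_sqrt_coef0 mulr1 f0.
have recE : fps_coef (fps_sqrt f) n.+1 = (fps_coef f n.+1
    - \sum_(1 <= i < n.+1)
        fps_coef (fps_sqrt f) i * fps_coef (fps_sqrt f) (n.+1 - i)) / 2.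
  rewrite {1}/fps_sqrt fps_rec_coef size_mkseq; congr ((_ - _) / _).
  apply: eq_big_nat => i /andP[i0 iN]; rewrite !nth_mkseq //.
  by rewrite ltn_subLR ?(ltnW iN) // -{1}[n.+1]add0n ltn_add2r.
by rewrite fps_sqr_coefS // recE divrK // addrC subrK.
Qed.

Lemma fps_sqrt_unique (R : comUnitRingType) (f g : {fps R}) :
    (2 : R) \is a GRing.unit -> fps_coef f 0 = 1 ->
    fps_coef g 0 = 1 -> g ^+ 2 = f ->
  g = fps_sqrt f.
Proof.
move=> U2 f0 g0 gf; apply/fpsP; elim/ltn_ind => -[//|n] IHn.
have := fps_sqr_coefS n (fps_sqrt_coef0 f).
rewrite fps_sqrtK // -{1}gf fps_sqr_coefS //.
rewrite (eq_big_nat _ _ (F2 := fun i =>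
  fps_coef (fps_sqrt f) i * fps_coef (fps_sqrt f) (n.+1 - i)%N)).
  by move/addrI/(mulIr U2).
move=> i /andP[i0 iN]; rewrite !IHn //.
by rewrite ltn_subLR ?(ltnW iN) // -{1}[n.+1]add0n ltn_add2r.
Qed.

(** Convergence in R[[x]] for the x-adic topology, R being discrete. *)

Definition fps_cvg (R : Type) (u : nat -> {fps R}) (f : {fps R}) : Prop :=
  forall n, exists N, forall k, (N <= k)%N ->
    fps_coef (u k) n = fps_coef f n.

(** [contfrac a b c m] is 1 / (a - b / (a - b / ( .. a - b / c))) with [m]
    occurrences of [a], hence [m.+1] fraction bars. *)

Fixpoint contfrac_denom (K : unitRingType) (a b c : K) (m : nat) : K :=
  if m is m'.+1 then a - b / contfrac_denom a b c m' else c.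

Definition contfrac (K : unitRingType) (a b c : K) (m : nat) : K :=
  1 / contfrac_denom a b c m.

(** f = 1 / (a - b / (a - b / (a - ..))): f is the limit of the convergents
    1 / a, 1 / (a - b / a), 1 / (a - b / (a - b / a)), .. *)

Definition is_infinite_contfrac (R : comUnitRingType) (a b f : {fps R}) : Prop :=
  fps_cvg (contfrac a b a) f.

Inductive step := stepU | stepF | stepD.

Definition step_code (s : step) : 'I_3 :=
  match s with stepU => inord 0 | stepF => inord 1 | stepD => inord 2 end.
Definition step_decode (i : 'I_3) : step :=
  match val i with 0%N => stepU | 1%N => stepF | _ => stepD end.
Lemma step_codeK : cancel step_code step_decode.
Proof. by case; rewrite /step_decode /= inordK. Qed.
HB.instance Definition _ := Equality.copy step (can_type step_codeK).
HB.instance Definition _ := Choice.copy step (can_type step_codeK).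
HB.instance Definition _ := Countable.copy step (can_type step_codeK).
HB.instance Definition _ := Finite.copy step (can_type step_codeK).

Definition rise (s : step) : int :=
  match s with stepU => 1 | stepF => 0 | stepD => -1 end.

Definition height (mu : seq step) (i : nat) : int :=
  \sum_(s <- take i mu) rise s.

Definition Motzkin (n : nat) : {set n.-tuple step} :=
  [set mu : n.-tuple step |
    [forall i : 'I_n.+1, 0 <= height mu i] && (height mu n == 0)].

Definition Motzkin_bounded (m n : nat) : {set n.-tuple step} :=
  [set mu in Motzkin n | [forall i : 'I_n.+1, height mu i <= m%:Z]].

(** The steps of mu at the positions i, ..., j - 1 form a nonempty run of U's. *)

Definition U_run (mu : seq step) (i j : nat) : bool :=
  [&& i < j, j <= size mu & all (pred1 stepU) (drop i (take j mu))]%N.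

Definition ascent (mu : seq step) (ij : 'I_(size mu).+1 * 'I_(size mu).+1) : bool :=
  U_run mu ij.1 ij.2 &&
  [forall kl : 'I_(size mu).+1 * 'I_(size mu).+1,
    [&& (kl.1 <= ij.1)%N, (ij.2 <= kl.2)%N & U_run mu kl.1 kl.2] ==> (kl == ij)].

Definition asc (mu : seq step) : nat := #|[set ij | @ascent mu ij]|.

(** Series in x with coefficients in rat[t]: a bivariate polynomial in x and t
    is an element of {poly {poly rat}}, the outer variable being x. *)

Definition F_asc_bounded (m : nat) : {fps {poly rat}} :=
  FPS (fun n => \sum_(mu in Motzkin_bounded m n) 'X^(asc mu)).

Definition F_asc : {fps {poly rat}} :=
  FPS (fun n => \sum_(mu in Motzkin n) 'X^(asc mu)).

Local Notation x := ('X : {poly {poly rat}}).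
Local Notation t := ('X%:P : {poly {poly rat}}).

Fixpoint P_asc (m : nat) : {poly {poly rat}} :=
  match m with
  | 0 => 1
  | 1 => 1 - x
  | (m''.+1 as m').+1 =>
      (1 - x - x ^+ 2 * (t - 1)) * P_asc m'
      - (x ^+ 2 + x ^+ 3 * (t - 1)) * P_asc m''
  end.

(* Main.v *)
(** Weighting the paths from height [h] to [0] inside the strip [0, m] by their
    remaining ascents, and remembering only whether the previous step was [U],
    gives a linear system determined by the expansion in powers of [x].  The
    first-passage decomposition solves it, with the factors [F_j] (paths in a
    strip of height [j]) and [A_j] (the same paths read after a [U]), where
    [F_j = 1 + x F_j + t x^2 A_(j-1) F_j] and
    [A_j = 1 + x F_j + x^2 A_(j-1) F_j].  Hence
    [t A_j = F_j + (t - 1) (1 + x F_j)], so that [F_j = 1 / (a - b F_(j-1))].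
    A path of length [n] has height at most [n], so [F] is the coefficientwise
    limit of the [F_m] and [b F^2 - a F + 1 = 0]; then [a - 2 b F] is the square
    root of [a^2 - 4 b] with constant coefficient 1. *)

Require Import Defs.
From mathcomp Require Import all_boot all_order all_algebra.
From mathcomp Require Import zify ring.

Import GRing.Theory.
Local Open Scope ring_scope.

Set Implicit Arguments.
Unset Strict Implicit.
Unset Printing Implicit Defensive.

Import Order.TTheory Num.Theory.

(** * Counting ascents while reading a path from left to right *)

Lemma U_runP (mu : seq step) (i j : nat) :
  reflect [/\ (i < j)%N, (j <= size mu)%N &
             forall k, (i <= k < j)%N -> nth stepF mu k = stepU]
          (U_run mu i j).
Proof.
apply: (iffP and3P) => -[ij jn H]; split=> //.
- move=> k /andP[ik kj]; move/(all_nthP stepF): H => /(_ (k - i)%N).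
  rewrite size_drop size_takel // nth_drop subnKC // nth_take // ltn_sub2r //.
  by move/(_ isT)/eqP.
- apply/(all_nthP stepF) => k; rewrite size_drop size_takel // => kji.
  have kj : (i + k < j)%N by rewrite -ltn_subRL.
  by rewrite nth_drop nth_take //=; apply/eqP/H; rewrite leq_addr.
Qed.

(** The step [p] stands for what precedes [mu], so position 0 needs no separate treatment. *)
Definition ascent_start (p : step) (mu : seq step) (i : nat) : bool :=
  (nth stepF mu i == stepU) && (nth stepF (p :: mu) i != stepU).

(** The number of ascents of [mu], not counting a first ascent that continues
    a preceding [U] step when [u] is true. *)
Fixpoint asc_from (u : bool) (mu : seq step) : nat :=
  match mu with
  | [::] => 0
  | stepU :: mu' => ~~ u + asc_from true mu'
  | _ :: mu' => asc_from false mu'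
  end.

Lemma sum_ascent_start (p : step) (mu : seq step) :
  (\sum_(i < size mu) ascent_start p mu i)%N = asc_from (p == stepU) mu.
Proof.
elim: mu p => [|s mu IH] p /=; first by rewrite big_ord0.
rewrite big_ord_recl [X in (_ + X)%N](_ : _ = asc_from (s == stepU) mu).
  rewrite /ascent_start /=; case: s {IH}; rewrite ?eqxx //.
  - by have /negPf-> : stepF != stepU by apply/eqP.
  - by have /negPf-> : stepD != stepU by apply/eqP.
by rewrite -IH; apply: eq_bigr.
Qed.

(* An ascent is determined by its starting position. *)
Lemma ascE (mu : seq step) : asc mu = asc_from false mu.
Proof.
have FU : (stepF == stepU) = false by apply/eqP.
rewrite -[false in RHS]FU.
rewrite -sum_ascent_start.
(* The index type of [ascent] also contains [size mu]; there the default [stepF] is read and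
   contributes 0. *)
have -> : (\sum_(i < size mu) ascent_start stepF mu i)%N
    = (\sum_(i < (size mu).+1) ascent_start stepF mu i)%N.
  rewrite big_ord_recr /= [X in (_ + X)%N](_ : _ = 0%N) ?addn0 //.
  by rewrite /ascent_start nth_default // FU.
rewrite -big_mkcond /= sum1dep_card /asc.
(* Two runs with a common start are nested, so maximality of the shorter one makes them equal. *)
have fst_inj : {in [set ij | @ascent mu ij] &, injective fst}.
  move=> [i j] [i' j']; rewrite !inE.
  move=> /andP[/= r1 /forallP m1] /andP[/= r2 /forallP m2] /= ii'.
  case: ii' r1 m1 r2 m2 => <- r1 m1 r2 m2.
  have [jj'|j'j] := leqP j j'.
  - by have := m1 (i, j'); rewrite /= leqnn jj' r2 /= => /eqP ->.
  - by have := m2 (i, j); rewrite /= leqnn (ltnW j'j) r1 /= => /eqP ->.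
rewrite -(card_in_imset fst_inj); apply: eq_card => i; rewrite [RHS]inE.
apply/imsetP/idP => [[[i' j]] | /andP[/eqP mui starti]].
- rewrite inE => /andP[/= /U_runP[ij jn H] /forallP mx] ->.
  rewrite /ascent_start H ?leqnn ?ij //= eqxx /=.
  case: i' ij H mx => [[|k] lek] /= ij H mx; first by rewrite FU.
  apply/eqP => muk; have lek' : (k < (size mu).+1)%N by exact: ltnW.
  have := mx (Ordinal lek', j); rewrite /= leqnSn leqnn /=.
  (* A [U] just before the start would extend the run to the left, against maximality. *)
  have -> : U_run mu k j.
    apply/U_runP; split=> [||l /andP[]] //; first exact: ltnW.
    rewrite leq_eqVlt => /orP[/eqP<- //|kl lj].
    by apply: H; rewrite kl.
  by move=> /eqP[] /eqP; rewrite ltn_eqF.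
- have iS : (i < size mu)%N.
    by rewrite ltnNge; apply/negP => le; move: mui; rewrite nth_default.
  have exj : exists j, U_run mu i j.
    exists i.+1; apply/U_runP; split=> // k.
    by rewrite ltnS -eqn_leq => /eqP <-.
  have bj j : U_run mu i j -> (j <= size mu)%N by case/U_runP.
  (* The longest run from [i] is an ascent: a run beginning earlier and containing it would contain
     the step before [i], which is not [U]. *)
  case: (ex_maxnP exj bj) => j rj mxj.
  exists (i, inord j) => //; rewrite inE /ascent /= inordK ?ltnS ?bj // rj /=.
  apply/forallP => -[k l]; apply/implyP => /= /and3P[ki jl rkl].
  have eki : k = i.
    apply/val_inj/eqP; rewrite /= eqn_leq ki leqNgt; apply/negP => ltki.
    case/U_runP: rkl => kl _ H; case/U_runP: rj => ij _ _.
    case: (nat_of_ord i) ltki ij starti => [//|i'] ltki ij /=.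
    by rewrite H ?eqxx //; apply/andP; split => //; lia.
  rewrite eki in rkl *; rewrite xpair_eqE eqxx /= -val_eqE /= inordK ?ltnS ?bj //.
  by rewrite eqn_leq jl mxj.
Qed.

(** * Heights, and paths confined to a strip *)

Lemma height_cons (s : step) (mu : seq step) (i : nat) :
  height (s :: mu) i.+1 = rise s + height mu i.
Proof. by rewrite /height /= big_cons. Qed.

Lemma height0 (mu : seq step) : height mu 0 = 0.
Proof. by rewrite /height take0 big_nil. Qed.

Lemma height_le (mu : seq step) (i : nat) : height mu i <= i%:Z.
Proof.
elim: mu i => [|s mu IH] [|i]; rewrite ?height0 //; first by rewrite /height big_nil.
by rewrite height_cons; have := IH i; case: s => /=; lia.
Qed.

Fixpoint strip_path (m h : nat) (mu : seq step) : bool :=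
  match mu with
  | [::] => h == 0%N
  | stepU :: mu' => (h < m)%N && strip_path m h.+1 mu'
  | stepF :: mu' => strip_path m h mu'
  | stepD :: mu' => (0 < h)%N && strip_path m h.-1 mu'
  end.

(** An arbitrary starting height lets the induction on the path go through: removing the first step
    only changes [h]. *)
Lemma strip_pathP (m h : nat) (mu : seq step) : (h <= m)%N ->
  reflect ((forall i, (i <= size mu)%N -> 0 <= h%:Z + height mu i <= m%:Z) /\
           h%:Z + height mu (size mu) = 0)
          (strip_path m h mu).
Proof.
elim: mu h => [|s mu IH] h hm.
  apply: (iffP eqP) => /= [->|[_]].
    by split=> [[|//] _|]; rewrite height0.
  by rewrite height0; lia.
have shift (h' : nat) : h'%:Z = h%:Z + rise s -> (h' <= m)%N ->
    reflect ((forall i, (i <= (size mu).+1)%N ->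
               0 <= h%:Z + height (s :: mu) i <= m%:Z) /\
             h%:Z + height (s :: mu) (size mu).+1 = 0) (strip_path m h' mu).
  move=> eh hm'; apply: (iffP (IH h' hm')) => -[H1 H2]; split.
  - case=> [_|i lei]; first by rewrite height0; lia.
    by rewrite height_cons addrA -eh; apply: H1.
  - by rewrite height_cons addrA -eh.
  - by move=> i lei; rewrite eh -addrA -height_cons; apply: H1.
  - by rewrite eh -addrA -height_cons.
case: s shift => /= shift.
- have [ltm|lem] /= := ltnP h m; first by apply: shift => //; lia.
  right=> -[/(_ 1%N isT)]; rewrite height_cons height0 /=; lia.
- by apply: shift => //; lia.
- case: h hm shift => [|h] hm shift /=; last by apply: shift; lia.
  right=> -[/(_ 1%N isT)]; rewrite height_cons height0 /=; lia.
Qed.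

Lemma Motzkin_boundedE (m n : nat) (mu : n.-tuple step) :
  (mu \in Motzkin_bounded m n) = strip_path m 0 mu.
Proof.
rewrite !inE; apply/andP/(strip_pathP _ (leq0n m)) => [[]|[]].
- move=> /andP[/forallP H1 /eqP H2] /forallP H3; rewrite size_tuple add0r; split=> // i lei; rewrite add0r.
  by have := H1 (inord i); have := H3 (inord i); rewrite !inordK // => -> ->.
- rewrite size_tuple add0r => H1 H2.
  have H i : 0 <= height mu (i : 'I_n.+1) <= m%:Z.
    by rewrite -[height _ _]add0r H1 // -ltnS.
  split; last by apply/forallP => i; case/andP: (H i).
  by rewrite H2 eqxx andbT; apply/forallP => i; case/andP: (H i).
Qed.

Lemma Motzkin_bounded_ge (m n : nat) : (n <= m)%N -> Motzkin_bounded m n = Motzkin n.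
Proof.
move=> nm; apply/setP => mu; rewrite inE andb_idr // => _.
apply/forallP => i; apply: le_trans (height_le _ _) _.
by rewrite lez_nat (leq_trans _ nm) // -ltnS.
Qed.

(** * Sums over words split by their first letter, and an algebraic tool *)

Lemma big_step (V : nmodType) (f : step -> V) :
  \sum_s f s = f stepU + f stepF + f stepD.
Proof.
have FU : stepF != stepU by apply/eqP.
have DUF : (stepD != stepU) && (stepD != stepF) by apply/andP; split; apply/eqP.
rewrite (bigD1 stepU) //= (bigD1 stepF FU) /= (bigD1 stepD DUF) /= big1 ?addr0 ?addrA //.
by case; rewrite ?eqxx ?andbF.
Qed.

Lemma big_tuple_cons (T : finType) (V : nmodType) (n : nat)
    (P : pred (seq T)) (f : seq T -> V) :
  \sum_(mu : n.+1.-tuple T | P mu) f mu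
    = \sum_s \sum_(mu : n.-tuple T | P (s :: mu)) f (s :: mu).
Proof.
rewrite pair_big_dep /=.
rewrite (reindex (fun p : T * n.-tuple T => [tuple of p.1 :: p.2])) //=.
exists (fun mu : n.+1.-tuple T => (thead mu, [tuple of behead mu])).
- by move=> [s mu] _; congr pair; apply: val_inj.
- by move=> mu _; apply: val_inj; case/tupleP: mu.
Qed.

(** Reduces a goal that follows from one known equation to a ring identity, once the cofactor [k] is
    supplied. *)
Lemma lincomb (V : comPzRingType) (k : V) (u v y z : V) :
  u = v -> y - z = k * (u - v) -> y = z.
Proof. by move=> ->; rewrite subrr mulr0 => /eqP; rewrite subr_eq0 => /eqP. Qed.

(** * Coefficients of products of power series *)

Section FormalPowerSeries.

Variable R : comNzRingType.
Implicit Types f g : {fps R}.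

Lemma fps_coefD f g n : fps_coef (f + g) n = fps_coef f n + fps_coef g n.
Proof. by []. Qed.

Lemma fps_coefB f g n : fps_coef (f - g) n = fps_coef f n - fps_coef g n.
Proof. by []. Qed.

Lemma fps_coef0M f g : fps_coef (f * g) 0 = fps_coef f 0 * fps_coef g 0.
Proof. by rewrite fps_coefM big_ord1. Qed.

Lemma fps_coefXM f n :
  fps_coef (('X)%:S * f) n = if n is n'.+1 then fps_coef f n' else 0.
Proof.
rewrite (@fps_mul_coef _ _ _ 'X (fps_trunc n.+1 f)) //; last first.
  by move=> i lei; rewrite fps_trunc_coef.
by rewrite coefXM; case: n => //= n; rewrite fps_trunc_coef // ltnW.
Qed.

Lemma fps_coefCM (c : R) f n : fps_coef ((c%:P)%:S * f) n = c * fps_coef f n.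
Proof.
rewrite (@fps_mul_coef _ _ _ c%:P (fps_trunc n.+1 f)) //; last first.
  by move=> i lei; rewrite fps_trunc_coef.
by rewrite coefCM fps_trunc_coef.
Qed.

Lemma fps_coefM_eq f f' g g' n :
    (forall i, (i <= n)%N -> fps_coef f i = fps_coef f' i) ->
    (forall i, (i <= n)%N -> fps_coef g i = fps_coef g' i) ->
  fps_coef (f * g) n = fps_coef (f' * g') n.
Proof.
move=> ff gg; rewrite !fps_coefM; apply: eq_bigr => i _.
by rewrite ff ?gg ?leq_subr // -ltnS.
Qed.

End FormalPowerSeries.

(** * Finite continued fractions and their convergence *)

Section ContinuedFraction.

Variables (R : comUnitRingType) (a b c : {fps R}).
Hypotheses (a0 : fps_coef a 0 = 1) (b0 : fps_coef b 0 = 0) (c0 : fps_coef c 0 = 1).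

Lemma fps_unit1 (f : {fps R}) : fps_coef f 0 = 1 -> f \is a GRing.unit.
Proof. by rewrite unit_fpsE => ->; apply: unitr1. Qed.

Lemma contfrac_denom_coef0 m : fps_coef (contfrac_denom a b c m) 0 = 1.
Proof.
case: m => [//|m]; rewrite [LHS](fps_coefB a (b / contfrac_denom a b c m)).
by rewrite fps_coef0M b0 mul0r subr0.
Qed.

Lemma contfrac_denom_unit m : contfrac_denom a b c m \is a GRing.unit.
Proof. exact/fps_unit1/contfrac_denom_coef0. Qed.

Lemma contfrac0_mul : c * contfrac a b c 0 = 1.
Proof. by rewrite /contfrac mulrCA mulrV ?mulr1 ?(contfrac_denom_unit 0). Qed.

Lemma contfracS_mul m : (a - b * contfrac a b c m) * contfrac a b c m.+1 = 1.
Proof.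
by rewrite /contfrac !div1r -[a - _]/(contfrac_denom a b c m.+1) mulrV ?contfrac_denom_unit.
Qed.

End ContinuedFraction.

(** By the fixed-point equation, the error of each convergent is a multiple of [b] times the
    previous error. Since [X] divides [b], every level gains one correct coefficient. *)
Lemma contfrac_cvg (R : comUnitRingType) (a b' f : {fps R}) :
    fps_coef a 0 = 1 -> (a - ('X)%:S * b' * f) * f = 1 ->
  is_infinite_contfrac a (('X)%:S * b') f.
Proof.
move=> a0 fE; set b := _ * b'.
have b0 : fps_coef b 0 = 0 by rewrite /b fps_coefXM.
suff H k n : (n <= k)%N -> fps_coef (contfrac a b a k) n = fps_coef f n.
  by move=> n; exists n => k; apply: H.
elim: k n => [|k IHk] n lenk.
  have E : contfrac a b a 0 - f = ('X)%:S * (- b' * f * f * contfrac a b a 0).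
    have := contfrac0_mul a0 b0 a0; move: (contfrac _ _ _ _) => g gE.
    (* Both inner products equal 1, by [fE] and [gE], so this combination is [g - f]. *)
    transitivity (g * ((a - b * f) * f) - f * (a * g)); last by rewrite /b; ring.
    by rewrite fE gE !mulr1.
  move: lenk; rewrite leqn0 => /eqP->.
  by apply/eqP; rewrite -subr_eq0 -fps_coefB E fps_coefXM.
have E : contfrac a b a k.+1 - f
    = ('X)%:S * (b' * f * contfrac a b a k.+1 * (contfrac a b a k - f)).
  have := contfracS_mul a0 b0 a0 k.
  move: (contfrac _ _ _ k.+1) (contfrac _ _ _ k) => g h gE.
  transitivity (g * ((a - b * f) * f) - f * ((a - b * h) * g)); last by rewrite /b; ring.
  by rewrite fE gE !mulr1.
apply/eqP; rewrite -subr_eq0 -fps_coefB E fps_coefXM.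
case: n lenk => [//|n] lenk.
rewrite (@fps_coefM_eq _ _ (b' * f * contfrac a b a k.+1) _ 0) ?mulr0 // => i lei.
by rewrite fps_coefB IHk ?subrr // (leq_trans lei).
Qed.

(** * Generating series of strip paths *)

Section StripPaths.

Variables (R : comUnitRingType) (t : R).

Local Notation X := (('X : {poly R})%:S).
Local Notation T := ((t%:P)%:S).
Local Notation a := (1 - X - X ^+ 2 * (T - 1)).
Local Notation b := (X ^+ 2 + X ^+ 3 * (T - 1)).
Local Notation G := (contfrac a b (1 - X)).

Definition strip_sum (m h : nat) (u : bool) (n : nat) : R :=
  \sum_(mu : n.-tuple step | strip_path m h mu) t ^+ asc_from u mu.

Lemma strip_sum0 m h u : strip_sum m h u 0 = (h == 0%N)%:R.
Proof.
rewrite /strip_sum (eq_bigl (fun=> h == 0%N)); last by move=> mu; rewrite tuple0.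
rewrite (eq_bigr (fun=> 1)); last by move=> mu _; rewrite tuple0.
case: (h == 0%N); last by rewrite big_pred0_eq.
by rewrite sumr_const card_tuple expn0.
Qed.

Lemma strip_sumS m h u n :
  strip_sum m h u n.+1 =
    (if (h < m)%N then (if u then 1 else t) * strip_sum m h.+1 true n else 0)
    + strip_sum m h false n
    + (if (0 < h)%N then strip_sum m h.-1 false n else 0).
Proof.
rewrite /strip_sum.
rewrite (@big_tuple_cons _ _ n (strip_path m h) (fun mu => t ^+ asc_from u mu)).
rewrite big_step /=; congr (_ + _ + _); case: ifP => _; rewrite ?big_pred0_eq //.
rewrite mulr_sumr; apply: eq_bigr => mu _.
by case: u; rewrite /= ?mul1r // exprS.
Qed.

Lemma a_coef0 : fps_coef a 0 = 1.
Proof.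
by rewrite !fps_coefB expr2 -mulrA !fps_coefXM fps_coef1 /= coefX !subr0.
Qed.

Lemma b_coef0 : fps_coef b 0 = 0.
Proof. by rewrite fps_coefD exprS [X ^+ 3]exprS -mulrA !fps_coefXM addr0. Qed.

Lemma c_coef0 : fps_coef (1 - X) 0 = 1.
Proof. by rewrite fps_coefB fps_coef1 /= coefX subr0. Qed.

(** The series of the strip paths of height at most [j], where a path beginning
    with [U] is weighted as if its first ascent continued an earlier one. *)
Fixpoint after_U_series (j : nat) : {fps R} :=
  1 + X * G j + if j is j'.+1 then X ^+ 2 * after_U_series j' * G j else 0.

Lemma after_U_seriesE j :
  after_U_series j = 1 + X * G j
    + if j is j'.+1 then X ^+ 2 * after_U_series j' * G j else 0.
Proof. by case: j. Qed.

(** The factor [T] stays on the left because it need not be invertible. Multiplied by [T], the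
    recursion contains [T * after_U_series j], where induction applies; the rest is a multiple of
    the continued fraction equation. *)
Lemma mul_after_U_series j : T * after_U_series j = G j + (T - 1) * (1 + X * G j).
Proof.
elim: j => [|j IHj]; rewrite after_U_seriesE.
  by apply: (lincomb (k := -1) (contfrac0_mul a_coef0 b_coef0 c_coef0)); ring.
have -> : T * (1 + X * G j.+1 + X ^+ 2 * after_U_series j * G j.+1)
    = T * (1 + X * G j.+1) + X ^+ 2 * (T * after_U_series j) * G j.+1 by ring.
rewrite IHj.
by apply: (lincomb (k := -1) (contfracS_mul a_coef0 b_coef0 c_coef0 j)); ring.
Qed.

Local Notation weight u := (if u then 1 else T).

(** Meant for paths that start and end on the floor of a strip of height [j]; [u] tells whether a
    [U] precedes them. *)
Definition floor_series (u : bool) (j : nat) : {fps R} :=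
  if u then after_U_series j else G j.

(** First-return decomposition: the path is empty, starts with [F], or starts with a [U] whose
    matching [D] resets the flag. *)
Lemma floor_seriesE u j :
  floor_series u j = 1 + X * G j
    + if j is j'.+1 then X ^+ 2 * (weight u * after_U_series j') * G j else 0.
Proof.
rewrite /floor_series; case: u.
  by rewrite after_U_seriesE; case: j => [//|j]; rewrite mul1r.
case: j => [|j].
  by apply: (lincomb (k := 1) (contfrac0_mul a_coef0 b_coef0 c_coef0)); ring.
rewrite mul_after_U_series.
by apply: (lincomb (k := 1) (contfracS_mul a_coef0 b_coef0 c_coef0 j)); ring.
Qed.

(** First-passage decomposition: after its last visit to height [h] before going
    below it for the first time, a path passes through [h.-1], .., [0], and its
    excursion above level [i] stays in a strip of height [m - i]. *)
Fixpoint descent_series (m h : nat) : {fps R} :=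
  if h is h'.+1 then X * (G (m - h')%N * descent_series m h') else 1.

(** The flag [u] enters only the first factor, since every later piece follows a [D]. *)
Definition strip_series (m h : nat) (u : bool) : {fps R} :=
  floor_series u (m - h)%N * descent_series m h.

(** This is the linear system of [strip_sumS], written for series. *)
Lemma strip_seriesE m h u : (h <= m)%N ->
  strip_series m h u = (h == 0%N)%:R + X *
    ((if (h < m)%N then weight u * strip_series m h.+1 true else 0)
     + strip_series m h false
     + (if (0 < h)%N then strip_series m h.-1 false else 0)).
Proof.
move=> hm; rewrite {1}/strip_series floor_seriesE.
have dE : descent_series m h = (h == 0%N)%:R + X *
    (if (0 < h)%N then strip_series m h.-1 false else 0).
  by case: h {hm} => [|h]; rewrite /= ?mulr0 ?addr0 ?add0r.
move: dE; move: (if (0 < h)%N then _ else _) => Z dE.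
have [hlm|mh] := ltnP h m.
  (* Writing [m - h] as a successor exposes the excursion term, and matches the [G] factor met on
     the descent from [h.+1]. *)
  rewrite -(subnSK hlm) /strip_series /= -(subnSK hlm).
  by apply: (lincomb (k := 1) dE); ring.
have -> : (m - h)%N = 0%N by apply/eqP; rewrite subn_eq0.
have -> : strip_series m h false = G 0 * descent_series m h.
  by rewrite /strip_series; have /eqP-> : (m - h == 0)%N by rewrite subn_eq0.
by apply: (lincomb (k := 1) dE); ring.
Qed.

(** The factor [X] makes the system determine each coefficient from those of the preceding index, so
    its solution is unique; all [h] and [u] are treated together. *)
Lemma strip_sumE m h u n : (h <= m)%N ->
  strip_sum m h u n = fps_coef (strip_series m h u) n.
Proof.
elim: n h u => [|n IHn] h u hm; rewrite strip_seriesE // fps_coefD fps_coefXM.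
  by rewrite strip_sum0 addr0; case: (h == 0%N); rewrite ?fps_coef1.
have -> : fps_coef ((h == 0%N)%:R : {fps R}) n.+1 = 0.
  by case: (h == 0%N); rewrite ?fps_coef1.
rewrite add0r strip_sumS !fps_coefD; congr (_ + _ + _).
- case: ifP => // hlm; rewrite IHn //.
  by case: u; rewrite ?mul1r // fps_coefCM.
- exact: IHn.
- by case: ifP => // h0; rewrite IHn // (leq_trans (leq_pred h)).
Qed.

Lemma strip_sum_contfrac m n : strip_sum m 0 false n = fps_coef (G m) n.
Proof. by rewrite strip_sumE // /strip_series subn0 mulr1. Qed.

End StripPaths.

(** * The ascent series over the polynomials in [t], the polynomials [P_asc], and the square root *)

Section AscentSeries.

Local Notation x := ('X : {poly {poly rat}}).
Local Notation t := ('X%:P : {poly {poly rat}}).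
Local Notation a := (1 - x - x ^+ 2 * (t - 1)).
Local Notation b := (x ^+ 2 + x ^+ 3 * (t - 1)).

Lemma a_fps : a%:S = 1 - x%:S - x%:S ^+ 2 * (t%:S - 1).
Proof. by rewrite !(rmorphB, rmorphM, rmorphXn, rmorph1). Qed.

Lemma b_fps : b%:S = x%:S ^+ 2 + x%:S ^+ 3 * (t%:S - 1).
Proof. by rewrite !(rmorphD, rmorphN, rmorphM, rmorphXn, rmorph1). Qed.

Lemma c_fps : (1 - x)%:S = 1 - x%:S.
Proof. by rewrite rmorphB rmorph1. Qed.

Lemma a_fps_coef0 : fps_coef a%:S 0 = 1.
Proof. by rewrite a_fps; apply: a_coef0. Qed.

Lemma b_fps_coef0 : fps_coef b%:S 0 = 0.
Proof. by rewrite b_fps; apply: b_coef0. Qed.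

Lemma c_fps_coef0 : fps_coef (1 - x)%:S 0 = 1.
Proof. by rewrite c_fps; apply: c_coef0. Qed.

Lemma F_asc_bounded_contfrac m :
  F_asc_bounded m = contfrac a%:S b%:S (1 - x)%:S m.
Proof.
rewrite a_fps b_fps c_fps; apply/fpsP => n; rewrite -strip_sum_contfrac.
by apply: eq_big => [mu|mu _]; rewrite ?Motzkin_boundedE ?ascE.
Qed.

Lemma P_ascSS m :
  (P_asc m.+2)%:S = a%:S * (P_asc m.+1)%:S - b%:S * (P_asc m)%:S.
Proof.
rewrite [LHS](rmorphB (@fps_of_poly {poly rat}) (a * P_asc m.+1) (b * P_asc m)).
by rewrite (rmorphM _ a) (rmorphM _ b).
Qed.

Lemma two_b_fps : (2 * b)%:S = 2 * b%:S.
Proof. by rewrite (rmorphM _ 2) rmorph_nat. Qed.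

Lemma P_asc_unit m : (P_asc m)%:S \is a GRing.unit.
Proof.
apply: fps_unit1; elim/ltn_ind: m => -[|[|m]] IHm.
- exact: fps_coef1.
- exact: c_fps_coef0.
- rewrite P_ascSS fps_coefB !fps_coef0M a_fps_coef0 b_fps_coef0.
  by rewrite IHm // mul1r mul0r subr0.
Qed.

(** Dividing the recurrence of [P_asc] by [P_asc m.+1] shows that the ratios of consecutive terms
    obey the recursion of the denominators. *)
Lemma contfrac_denom_P_asc m :
  contfrac_denom a%:S b%:S (1 - x)%:S m * (P_asc m)%:S = (P_asc m.+1)%:S.
Proof.
elim: m => [|m IHm]; first by rewrite [LHS]mulr1.
rewrite P_ascSS -[contfrac_denom _ _ _ _]/
  (a%:S - b%:S / contfrac_denom a%:S b%:S (1 - x)%:S m).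
(* Only the copy of [P_asc m.+1] multiplied by [b] is expanded, so that the denominator cancels
   there. *)
rewrite mulrBl -{2}IHm mulrA divrK //.
exact: contfrac_denom_unit a_fps_coef0 b_fps_coef0 c_fps_coef0 m.
Qed.

Lemma P_asc_contfrac m :
  (P_asc m)%:S / (P_asc m.+1)%:S = contfrac a%:S b%:S (1 - x)%:S m.
Proof.
rewrite -contfrac_denom_P_asc /contfrac invrM ?P_asc_unit ?mulrA ?divrr ?P_asc_unit //.
exact: contfrac_denom_unit a_fps_coef0 b_fps_coef0 c_fps_coef0 m.
Qed.

Lemma F_asc_stable m n : (n <= m)%N ->
  fps_coef F_asc n = fps_coef (F_asc_bounded m) n.
Proof. by move=> nm; rewrite /F_asc /F_asc_bounded /= Motzkin_bounded_ge. Qed.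

(** Coefficient [n] involves only indices up to [n], where [F_asc] agrees with the bounded series
    for [n] and [n.+1]; their relation therefore passes to the limit. *)
Lemma F_asc_eq : (a%:S - b%:S * F_asc) * F_asc = 1.
Proof.
apply/fpsP => n.
rewrite -(contfracS_mul a_fps_coef0 b_fps_coef0 c_fps_coef0 n).
rewrite -!F_asc_bounded_contfrac; apply: fps_coefM_eq => i lein.
  rewrite !fps_coefB; congr (_ - _); apply: fps_coefM_eq => // k leki.
  by apply: F_asc_stable; apply: leq_trans lein.
by apply: F_asc_stable; apply: leqW.
Qed.

Lemma F_asc_sqrt :
  a%:S - (2 * b)%:S * F_asc
    = fps_sqrt (1 - 2 * x - x ^+ 2 * (2 * t + 1)
                - 2 * x ^+ 3 * (t - 1) + x ^+ 4 * (t - 1) ^+ 2)%:S.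
Proof.
set d := (d in fps_sqrt d%:S).
have dE : d%:S = a%:S ^+ 2 - 4 * b%:S.
  rewrite -rmorphXn -(rmorph_nat (@fps_of_poly {poly rat}) 4) -rmorphM -rmorphB.
  by congr _%:S; rewrite /d; ring.
apply: fps_sqrt_unique.
- by rewrite -(rmorph_nat (@polyC rat) 2); apply: rmorph_unit; rewrite unitfE.
- rewrite dE fps_coefB expr2 !fps_coef0M a_fps_coef0 b_fps_coef0.
  by rewrite mulr0 subr0 mulr1.
- rewrite fps_coefB two_b_fps !fps_coef0M a_fps_coef0 b_fps_coef0.
  by rewrite mulr0 mul0r subr0.
(* The square minus [d] is -4b times the defect of the quadratic equation for [F_asc]. *)
- rewrite dE two_b_fps; apply: (lincomb (k := - 4 * b%:S) F_asc_eq).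
  by move: (a%:S) (b%:S) F_asc => a' b' f; ring.
Qed.

End AscentSeries.

Theorem theorem6 :
  let x : {poly {poly rat}} := 'X in
  let t : {poly {poly rat}} := 'X%:P in
  let a := 1 - x - x ^+ 2 * (t - 1) in
  let b := x ^+ 2 + x ^+ 3 * (t - 1) in
  (forall m : nat, (1 <= m)%N ->
     F_asc_bounded m = (P_asc m)%:S / (P_asc m.+1)%:S /\
     (P_asc m)%:S / (P_asc m.+1)%:S = contfrac a%:S b%:S (1 - x)%:S m) /\
  is_infinite_contfrac a%:S b%:S F_asc /\
  tofrac F_asc =
    (tofrac (1 - x - x ^+ 2 * (t - 1))%:S
     - tofrac (fps_sqrt (1 - 2 * x - x ^+ 2 * (2 * t + 1)
                         - 2 * x ^+ 3 * (t - 1) + x ^+ 4 * (t - 1) ^+ 2)%:S))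
    / tofrac (2 * (x ^+ 2 + x ^+ 3 * (t - 1)))%:S.
Proof.
move=> x t a b; split=> [m _|].
  by rewrite P_asc_contfrac F_asc_bounded_contfrac.
split.
  (* Exhibits the factor [X] of [b] that drives the convergence. *)
  have bE : b%:S = x%:S * (x + x ^+ 2 * (t - 1))%:S.
    by rewrite -rmorphM; congr _%:S; rewrite /b; ring.
  rewrite bE; apply: contfrac_cvg; first exact: a_fps_coef0.
  by rewrite -bE; apply: F_asc_eq.
(* As [b] has constant coefficient 0, the quotient is taken in the fraction field; 2b is nonzero
   because its coefficient of index 2 is 2. *)
have nz : (2 * b)%:S != 0.
  apply/eqP => /fpsP /(_ 2%N) /=.
  rewrite mulr_natl coefMn coefD coefXn coefXnM /= addr0 => /eqP.
  by rewrite -polyC_natr polyC_eq0.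
rewrite -F_asc_sqrt -rmorphB subKr (rmorphM _ (2 * b)%:S) mulrAC divff ?mul1r //.
by rewrite tofrac_eq0.
Qed.
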